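(* Let $\mu$ be a measure on $[0,1]$, let $\Phi=\{\phi_j\}_{j=1}^\infty$ be an orthonormal basis of $L^2([0,1],\mu)$, and let $A>0$, $k>1/2$, $C>0$ be constants. Then, as $\epsilon\to0$, $$M_2(\epsilon,\Theta_k(\Phi,A,C))\asymp \epsilon^{-2/(2k-1)}.$$
   Context: Every $f\in L^2([0,1],\mu)$ has a unique expansion $f=\sum_{j\ge1}\theta_j\phi_j$ with $\sum_j\theta_j^2<\infty$. The approximate sparsity class $\Theta_k(\Phi,A,C)$ is the set of $f=\sum_j\theta_j\phi_j\in L^2([0,1],\mu)$ such that (a) the non-increasing rearrangement $\{\theta_{(j)}\}_{j\ge1}$ of the coefficients by absolute value ($\theta_{(j)}$ is the $j$-th largest in absolute value) satisfies $|\theta_{(j)}|\le Aj^{-k}$ for all $j\ge1$, and (b) for all $J\ge1$, $\sum_{j=J+1}^\infty\theta_j^2\le CJ^{-2k+1}$. For $\mathcal{F}\subseteq L^2([0,1],\mu)$, $M_2(\epsilon,\mathcal{F}):=\log N(\epsilon,\mathcal{F})$, where $N(\epsilon,\mathcal{F})$ is the cardinality of the largest $\epsilon$-packing set of $\mathcal{F}$ in the $L^2([0,1],\mu)$ distance. $a(\epsilon)\asymp b(\epsilon)$ means there are constants $0<c_1\le c_2<\infty$ with $c_1b(\epsilon)\le a(\epsilon)\le c_2 b(\epsilon)$ for all sufficiently small $\epsilon$. *)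

(* Defs.v *)
From HB Require Import structures.
From mathcomp Require Import all_boot all_order all_algebra.
From mathcomp Require Import all_classical all_reals all_analysis.
Set Implicit Arguments.
Unset Strict Implicit.
Unset Printing Implicit Defensive.
Import Order.TTheory GRing.Theory Num.Theory.
Import numFieldNormedType.Exports.
Local Open Scope classical_set_scope.
Local Open Scope ring_scope.

Section Defs.
Context {R : realType}.
Implicit Types (mu : {measure set R -> \bar R}) (f g : R -> R).

(* L^2(mu) membership: measurable with finite L^2 norm. The measure mu lives on
   the Borel sets of R and is assumed (in the theorem) to be concentrated on
   [0,1], so that L^2(R,mu) = L^2([0,1],mu). *)
Definition L2 mu f : Prop := f \in Lfun mu 2%:E.

Definition L2norm mu f : \bar R := 'N[mu]_2%:E[EFin \o f].

Definition L2dist mu f g : \bar R := L2norm mu (fun x => f x - g x).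

Definition ip mu f g : R := Rintegral mu setT (fun x => f x * g x).

(* Orthonormal basis (phi j)_{j>=0} of L^2(mu) (paper's phi_{j+1} is phi j):
   orthonormal family whose Fourier partial sums converge in L^2 to every f. *)
Definition orthonormal_basis mu (phi : nat -> R -> R) : Prop :=
  [/\ (forall j, L2 mu (phi j)),
      (forall i j, ip mu (phi i) (phi j) = (i == j)%:R) &
      (forall f, L2 mu f ->
         (fun n : nat => L2norm mu (fun x => f x - \sum_(j < n) ip mu f (phi j) * phi j x))
           @ \oo --> 0%E)].

Definition coef mu (phi : nat -> R -> R) f (j : nat) : R := ip mu f (phi j).

(* non-increasing rearrangement (j >= 1): the j-th largest value of |theta|,
   i.e. the largest t such that at least j (distinct-index) entries satisfy |theta_i| >= t *)
Definition decr_rearr (theta : nat -> R) (j : nat) : R :=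
  sup [set t : R | exists s : 'I_j -> nat,
         injective s /\ forall i, t <= `|theta (s i)|].

Definition Theta mu (phi : nat -> R -> R) (k A C : R) : set (R -> R) :=
  [set f | [/\ L2 mu f,
    (forall j : nat, (0 < j)%N -> decr_rearr (coef mu phi f) j <= A * (j%:R `^ (- k))) &
    (forall J : nat, (0 < J)%N ->
       (\sum_(J <= i <oo) ((coef mu phi f i) ^+ 2)%:E <= (C * J%:R `^ (1 - 2 * k))%:E)%E)]].

Definition is_packing mu (eps : R) (F : set (R -> R)) (n : nat) : Prop :=
  exists P : 'I_n -> R -> R, (forall i, F (P i)) /\
    (forall i j, i != j -> (eps%:E < L2dist mu (P i) (P j))%E).

Definition packing_number mu (eps : R) (F : set (R -> R)) : \bar R :=
  ereal_sup [set (n%:R)%:E | n in is_packing mu eps F].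

Definition M2 mu (eps : R) (F : set (R -> R)) : \bar R :=
  match packing_number mu eps F with
  | r%:E => (ln r)%:E
  | +oo%E => +oo%E
  | -oo%E => -oo%E
  end.

End Defs.

(* Main.v *)
Require Import Defs.
From HB Require Import structures.
From mathcomp Require Import all_boot all_order all_algebra.
From mathcomp Require Import all_classical all_reals all_analysis.
From mathcomp Require Import ring lra.
Import Order.TTheory GRing.Theory Num.Theory.
Import numFieldNormedType.Exports.
Local Open Scope classical_set_scope.
Local Open Scope ring_scope.

(* Upper bound: choose J of order eps^(-2/(2k-1)), so that the tails beyond J
   are at most of order eps, and round the first J coefficients to multiples of
   eta, of order J^-k, so that equal roundings force distance at most eps.  If
   m_i is the rounded modulus of the i-th coefficient, the j-th largest m_i is
   at most c (J/j)^k, hence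
     \prod_(i < J) (1 + m_i) <= ((1 + c)^J (J^J / J!)^k) <= ((1 + c) e^k)^J,
   and only exponentially many (in J) integer vectors satisfy such a bound:
   there is no logarithmic loss.
   Lower bound: a Gilbert-Varshamov code in {0, a}^J with a of order J^-k. *)

(** * Counting integer vectors under a product constraint *)

(** The quotient of [n ^ n] by [n!] is a single term of the exponential series at [n]. This bound is
    what avoids a logarithmic factor in the count. *)
Lemma exprn_le_fact_expR (R : realType) (n : nat) :
  n%:R ^+ n <= n`!%:R * expR n%:R :> R.
Proof.
case: n => [|n]; first by rewrite expr0 fact0 mul1r expR0.
have f0 : 0 < (n.+1)`!%:R :> R by rewrite ltr0n fact_gt0.
rewrite mulrC -ler_pdivrMr //.
by apply: le_trans (expR_ge1Dxn n (ler0n R n.+1)); rewrite lerDr.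
Qed.

Lemma sum_inv_sqr_le2 (R : realType) (n : nat) :
  \sum_(m < n) ((1 + m%:R) ^+ 2)^-1 <= 2 :> R.
Proof.
(* The sharper bound makes the induction close: with x = p + 1, the slack 1/x - 1/(x+1) - 1/(x+1)^2
   is exactly 1/(x (x+1)^2). *)
have H p : \sum_(m < p.+1) ((1 + m%:R) ^+ 2)^-1 <= 2 - (1 + p%:R)^-1 :> R.
  elim: p => [|p IH].
    by rewrite big_ord_recr big_ord0 /= addr0 expr1n invr1; lra.
  rewrite big_ord_recr /=; apply: le_trans (lerD IH (lexx _)) _.
  have p0 : 0 < 1 + p%:R :> R by rewrite addrC natr1 ltr0n.
  rewrite -[p.+1%:R]natr1 -subr_ge0.
  set x := _ + _ in p0 *; have -> : 1 + (p%:R + 1) = x + 1 by rewrite /x; ring.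
  rewrite [leRHS](_ : _ = (x * (x + 1) ^+ 2)^-1); last first.
    by field; apply/andP; split; apply: lt0r_neq0; lra.
  by rewrite invr_ge0 mulr_ge0 ?sqr_ge0 // ltW.
case: n => [|n]; first by rewrite big_ord0.
apply: le_trans (H n) _; rewrite lerBlDr lerDl invr_ge0.
by rewrite addr_ge0.
Qed.

Lemma card_le_sum (R : realType) (T : finType) (S : {set T}) (w : T -> R) :
  (forall x, 0 <= w x) -> (forall x, x \in S -> 1 <= w x) ->
  #|S|%:R <= \sum_x w x.
Proof.
move=> w0 wS; rewrite -sum1_card natr_sum big_mkcond /=.
by apply: ler_sum => x _; case: ifP => // /wS.
Qed.

(* Chernoff bound: each such [f] has weight at least [1] under
   [P^2 * \prod_i (1 + |f i|)^-2], whose sum over all [f] factorizes. *)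
Lemma card_prod_bound (R : realType) (J N : nat) (P : R) :
  0 <= P ->
  #|[set f : {ffun 'I_J -> bool * 'I_N} |
      \prod_i (1 + (f i).2%:R) <= P :> R]%SET|%:R <= P ^+ 2 * 4 ^+ J.
Proof.
move=> P0.
pose w (p : bool * 'I_N) : R := ((1 + p.2%:R) ^+ 2)^-1.
have p1 (p : bool * 'I_N) : 0 < 1 + p.2%:R :> R by rewrite addrC natr1 ltr0n.
have w0 p : 0 <= w p by rewrite /w invr_ge0 exprn_ge0 // ltW.
apply: le_trans
  (card_le_sum _ _ _
    (fun f : {ffun _ -> _} => P ^+ 2 * \prod_i w (f i)) _ _) _.
- by move=> f; rewrite mulr_ge0 ?exprn_ge0 // prodr_ge0.
- move=> f; rewrite inE => fP.
  rewrite prodfV prodrXl ler_pdivlMr; last first.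
    by rewrite exprn_gt0 // prodr_gt0.
  rewrite mul1r lerXn2r ?nnegrE // prodr_ge0 // => i _; exact: ltW.
rewrite -mulr_sumr ler_wpM2l ?exprn_ge0 //.
rewrite -(bigA_distr_bigA (fun _ : 'I_J => w)) /= prodr_const card_ord.
rewrite lerXn2r ?nnegrE ?sumr_ge0 //.
(* Two signs, each contributing at most 2, give the factor 4 per coordinate. *)
rewrite -(pair_bigA _ (fun a b => w (a, b))) big_bool /w /=.
have := sum_inv_sqr_le2 R N; lra.
Qed.

(** * Binary codes with large Hamming distance *)

Definition hamming {T : finType} (f g : {ffun T -> bool}) : nat :=
  #|[set i | f i != g i]%SET|.

Lemma hammingC {T : finType} (f g : {ffun T -> bool}) :
  hamming f g = hamming g f.
Proof. by apply: eq_card => i; rewrite !inE eq_sym. Qed.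

(** Again a Chernoff bound: the weight (3/2)^J (2/3)^(4d), with d the distance to [f], is at least 1
    on the ball. It factorizes into coordinate sums 1 + (2/3)^4 = 97/81, and 3/2 * 97/81 = 97/54.
    What matters is that this base is below 2. *)
Lemma card_hamming_ball (R : realType) (J : nat) (f : {ffun 'I_J -> bool}) :
  #|[set g | (4 * hamming f g <= J)%N]%SET|%:R <= (97 / 54) ^+ J :> R.
Proof.
pose q : R := (2 / 3) ^+ 4.
pose w (i : 'I_J) (b : bool) : R := if f i != b then q else 1.
have w0 i b : 0 <= w i b by rewrite /w /q; case: ifP => _; lra.
apply: le_trans (card_le_sum _ _ _
  (fun g : {ffun _ -> _} => (3 / 2) ^+ J * \prod_i w i (g i)) _ _) _.
- by move=> g; rewrite mulr_ge0 ?exprn_ge0 // prodr_ge0.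
- move=> g; rewrite inE => Hg.
  rewrite /w -big_mkcond /= prodr_const.
  have -> : #|(fun i => f i != g i)| = hamming f g.
    by apply: eq_card => i; rewrite !inE.
  rewrite /q -exprM.
  have <- : (3 / 2) ^+ (J - 4 * hamming f g) * (3 / 2) ^+ (4 * hamming f g)
     = (3 / 2) ^+ J :> R by rewrite -exprD subnK.
  rewrite -mulrA -exprMn (_ : 3 / 2 * (2 / 3) = 1 :> R); last by field.
  by rewrite expr1n mulr1 exprn_ege1 //; lra.
rewrite -mulr_sumr -(bigA_distr_bigA w) /=.
rewrite (eq_bigr (fun=> 1 + q)); last first.
  by move=> i _; rewrite big_bool /w; case: (f i) => /=; rewrite // addrC.
rewrite prodr_const card_ord -exprMn lerXn2r ?nnegrE //; rewrite /q; lra.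
Qed.

(* Gilbert-Varshamov: the balls around a maximal code cover the cube. *)
Lemma gilbert_varshamov (R : realType) (J : nat) :
  exists S : {set {ffun 'I_J -> bool}},
    {in S &, forall f g, f != g -> (J < 4 * hamming f g)%N} /\
    (108 / 97) ^+ J <= #|S|%:R :> R.
Proof.
pose code (S : {set {ffun 'I_J -> bool}}) :=
  [forall f in S, forall g in S, (f != g) ==> (J < 4 * hamming f g)%N].
have [|S /maxsetP[cS maxS]] := @ex_maxset _ code.
  by exists finset.set0; apply/forallP => f; rewrite inE.
have sep : {in S &, forall f g, f != g -> (J < 4 * hamming f g)%N}.
  move=> f g fS gS; move/forall_inP: cS => /(_ f fS)/forall_inP/(_ g gS).
  by move/implyP.
exists S; split=> //.
have cover g : exists2 f, f \in S & (4 * hamming f g <= J)%N.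
  have [gS|gS] := boolP (g \in S).
    exists g => //; rewrite /hamming (_ : finset _ = finset.set0) ?cards0 //.
    by apply/setP => i; rewrite !inE eqxx.
  (* A word farther than J/4 from all of [S] could be added to the code, so maximality would put it
     in [S] already. *)
  apply/exists_inP; apply: contraNT gS; rewrite negb_exists_in => /forall_inP far.
  rewrite -(maxS (g |: S)%SET) ?setU11 ?subsetU1 //.
  apply/forall_inP => f1; rewrite in_setU1 => /predU1P[->|f1S];
    apply/forall_inP => f2; rewrite in_setU1 => /predU1P[->|f2S];
    apply/implyP => // ne; first by rewrite eqxx in ne.
  - by rewrite hammingC ltnNge far.
  - by rewrite ltnNge far.
  - exact: sep.
(* Double counting of the pairs formed by a code word and an element of its ball. *)
have vol : (2 ^ J <= \sum_(f in S) #|[set g | (4 * hamming f g <= J)%N]%SET|)%N.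
  rewrite -[X in (X ^ _)%N]card_bool -{1}[J]card_ord -card_ffun -sum1_card.
  under [leqRHS]eq_bigr do rewrite -sum1_card big_mkcond.
  rewrite exchange_big /=; apply: leq_sum => g _.
  have [f fS fg] := cover g.
  by rewrite (bigD1 f) //= inE fg.
have b0 : 0 < 97 / 54 :> R by lra.
rewrite (_ : 108 / 97 = 2 / (97 / 54)); last by field.
rewrite expr_div_n ler_pdivrMr ?exprn_gt0 // -natrX.
apply: (@le_trans _ _ (\sum_(f in S) (97 / 54) ^+ J)); last first.
  by rewrite sumr_const -[leLHS]mulr_natl.
move: vol; rewrite -(ler_nat R) => /le_trans; apply.
by rewrite natr_sum; apply: ler_sum => f _; exact: card_hamming_ball.
Qed.

(** * Products and suprema governed by the decreasing rearrangement *)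

Lemma prod_le_of_rearrangement (R : realType) (I : finType) (u : I -> R)
    (b : nat -> R) :
  (forall i, 0 <= u i) ->
  (forall (S : {set I}) t, (0 < #|S|)%N -> {in S, forall i, t <= u i} ->
     t <= b #|S|) ->
  forall S : {set I},
    \prod_(i in S) (1 + u i) <= \prod_(j < #|S|) (1 + b j.+1).
Proof.
move=> u0 ub S; move En: #|S| => n; elim: n S En => [|n IH] S Sn.
  by move/eqP: Sn; rewrite cards_eq0 => /eqP ->; rewrite big_set0 big_ord0.
have /card_gt0P[i0 i0S] : (0 < #|S|)%N by rewrite Sn.
have [i iS imin] : exists2 i, i \in S & forall j, j \in S -> u i <= u j.
  by case: (arg_minP u i0S) => i iS imin; exists i.
rewrite (big_setD1 i) //= big_ord_recr /= mulrC ler_pM //.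
- by rewrite prodr_ge0 // => j _; rewrite addr_ge0.
- by rewrite addr_ge0.
- by apply: IH; move: Sn; rewrite (cardsD1 i) iS => -[].
- by rewrite lerD2l -Sn; apply: ub; rewrite ?Sn.
Qed.

Lemma powRN_le (R : realType) (p x y : R) : 0 <= p -> 0 < x -> x <= y ->
  y `^ (- p) <= x `^ (- p).
Proof.
move=> p0 x0 xy; have y0 := lt_le_trans x0 xy.
rewrite !powRN lef_pV2 ?posrE ?powR_gt0 //.
by apply: ge0_ler_powR; rewrite ?nnegrE // ltW.
Qed.

Lemma prod_powR (R : realType) (k : R) (n : nat) (F : 'I_n -> R) :
  (forall i, 0 <= F i) -> \prod_i (F i `^ k) = (\prod_i F i) `^ k.
Proof.
move=> F0; elim: n F F0 => [|n IH] F F0; first by rewrite !big_ord0 powR1.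
rewrite !big_ord_recr /= IH // powRM //; exact: prodr_ge0.
Qed.

Lemma natr_fact (R : realType) (n : nat) :
  n`!%:R = \prod_(j < n) j.+1%:R :> R.
Proof.
elim: n => [|n IH]; first by rewrite big_ord0.
by rewrite factS natrM big_ord_recr /= IH mulrC.
Qed.

Lemma prod_rearrangement_bound (R : realType) (c k : R) (J : nat) :
  0 <= c -> 0 <= k ->
  \prod_(j < J) (1 + c * (J%:R / j.+1%:R) `^ k)
    <= ((1 + c) * expR k) ^+ J.
Proof.
move=> c0 k0; have e1 : 1 `^ k = 1 :> R by rewrite powR1.
apply: (@le_trans _ _ (\prod_(j < J) ((1 + c) * (J%:R / j.+1%:R) `^ k))).
  (* As j + 1 <= J, the power is at least 1 and absorbs the summand 1. *)
  apply: ler_prod => j _; rewrite addr_ge0 ?mulr_ge0 ?powR_ge0 //=.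
  rewrite mulrDl mul1r lerD2r -[leLHS]e1.
  apply: ge0_ler_powR; rewrite ?nnegrE ?divr_ge0 //.
  by rewrite ler_pdivlMr // mul1r ler_nat.
rewrite big_split /= prodr_const card_ord exprMn ler_wpM2l ?exprn_ge0 ?addr_ge0 //.
rewrite prod_powR => [|j]; last by rewrite divr_ge0.
rewrite big_split /= prodr_const card_ord prodfV -natr_fact.
rewrite -expRM_natr [k * _]mulrC expRM; apply: ge0_ler_powR => //.
- by rewrite nnegrE divr_ge0 ?exprn_ge0.
- by rewrite nnegrE expR_ge0.
- by rewrite ler_pdivrMr ?ltr0n ?fact_gt0 // mulrC exprn_le_fact_expR.
Qed.

(** The bound [M] and [0 < j] make the set under the [sup] bounded above; on an unbounded set [sup]
    would only return a default value. *)
Lemma le_decr_rearr (R : realType) (theta : nat -> R) (M t : R) (j : nat)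
    (s : 'I_j -> nat) :
  (forall i, `|theta i| <= M) -> (0 < j)%N ->
  injective s -> (forall i, t <= `|theta (s i)|) -> t <= decr_rearr theta j.
Proof.
move=> thM j0 sinj ts; apply: sup_upper_bound; last by exists s.
split; first by exists t, s.
exists M => r [s' [_ /(_ (Ordinal j0)) h]]; exact: le_trans h (thM _).
Qed.

Lemma decr_rearr_le (R : realType) (theta : nat -> R) (c : R) (j : nat) :
  (forall s : 'I_j -> nat, injective s -> exists i, `|theta (s i)| <= c) ->
  0 <= c -> decr_rearr theta j <= c.
Proof.
move=> H c0; rewrite /decr_rearr; set E := (X in sup X).
(* The [sup] of the empty set is 0 by convention; [0 <= c] covers this case. *)
have [->|/set0P E0] := eqVneq E set0; first by rewrite sup0.
apply: ge_sup => // t [s [sinj ts]].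
by have [i hi] := H s sinj; exact: le_trans (ts i) hi.
Qed.

(** * Inner products and Fourier sums in L2 *)

Section L2.
Context {R : realType} (mu : {measure set R -> \bar R}).
Implicit Types f g h : R -> R.

Lemma L2_lin f g (a : R) :
  L2 mu f -> L2 mu g -> L2 mu (fun x => a * f x + g x).
Proof. exact: (@Lfun_submod_closed _ _ _ mu _ (lee1n 2)).2. Qed.

Lemma L20 : L2 mu (fun=> 0).
Proof. exact: (@Lfun_submod_closed _ _ _ mu _ (lee1n 2)).1. Qed.

Lemma L2B f g : L2 mu f -> L2 mu g -> L2 mu (fun x => f x - g x).
Proof.
move=> f2 g2; rewrite (_ : (fun=> _) = (fun x => -1 * g x + f x)).
  exact: L2_lin.
by apply/funext => x; rewrite mulN1r addrC.
Qed.

Lemma L2_integrableM f g : L2 mu f -> L2 mu g ->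
  mu.-integrable setT (EFin \o (fun x => f x * g x)).
Proof. by move=> f2 g2; apply/Lfun1_integrable; exact: Lfun2_mul_Lfun1. Qed.

Lemma ipC f g : ip mu f g = ip mu g f.
Proof. by apply: eq_Rintegral => x _; rewrite mulrC. Qed.

Lemma ip_lin f g h (a : R) : L2 mu f -> L2 mu g -> L2 mu h ->
  ip mu (fun x => a * f x + g x) h = a * ip mu f h + ip mu g h.
Proof.
move=> f2 g2 h2; rewrite /ip -RintegralZl //; last exact: L2_integrableM.
rewrite -RintegralD //; first by apply: eq_Rintegral => x _; rewrite mulrDl mulrA.
(* Adding the zero function lets [L2_lin] show that the scalar multiple of [f] is in L2. *)
- rewrite (_ : _ \o _ = EFin \o (fun x => (a * f x + 0) * h x)).
    by apply: L2_integrableM => //; apply: L2_lin => //; exact: L20.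
  by apply/funext => x /=; rewrite addr0 mulrA.
- exact: L2_integrableM.
Qed.

Lemma ip0 h : ip mu (fun=> 0) h = 0.
Proof.
rewrite /ip (eq_Rintegral mu (g := fun=> 0)) => [|x _]; last by rewrite mul0r.
by rewrite /Rintegral integral0.
Qed.

Lemma ipB f g h : L2 mu f -> L2 mu g -> L2 mu h ->
  ip mu (fun x => f x - g x) h = ip mu f h - ip mu g h.
Proof.
move=> f2 g2 h2; rewrite -[X in _ = X]addrC -mulN1r -ip_lin //.
by congr ip; apply/funext => x; rewrite mulN1r addrC.
Qed.

Lemma L2normE f : L2 mu f -> L2norm mu f = (Num.sqrt (ip mu f f))%:E.
Proof.
move=> f2; rewrite /L2norm unlock /= -powR12_sqrt; last first.
  by apply: Rintegral_ge0 => x _; rewrite -expr2 sqr_ge0.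
(* The integral is finite, so [fine] loses nothing. *)
rewrite -poweR_EFin /ip /Rintegral fineK; last first.
  by apply: integrable_fin_num => //; exact: L2_integrableM.
congr poweR; apply: eq_integral => x _ /=.
by rewrite powR_mulrn // real_normK ?num_real // expr2.
Qed.

Variables (phi : nat -> R -> R) (phiP : orthonormal_basis mu phi).

Definition fourier_sum (a : nat -> R) (n : nat) : R -> R :=
  fun x => \sum_(j < n) a j * phi j x.

Lemma fourier_sumS a n :
  fourier_sum a n.+1 = (fun x => a n * phi n x + fourier_sum a n x).
Proof. by apply/funext => x; rewrite /fourier_sum big_ord_recr /= addrC. Qed.

Lemma fourier_sum0 a : fourier_sum a 0 = (fun=> 0).
Proof. by apply/funext => x; rewrite /fourier_sum big_ord0. Qed.

Lemma L2_basis j : L2 mu (phi j).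
Proof. by case: phiP. Qed.

Lemma L2_fourier_sum a n : L2 mu (fourier_sum a n).
Proof.
elim: n => [|n IH]; first by rewrite fourier_sum0; exact: L20.
by rewrite fourier_sumS; apply: L2_lin => //; exact: L2_basis.
Qed.

Lemma ip_fourier_sum a n h : L2 mu h ->
  ip mu (fourier_sum a n) h = \sum_(j < n) a j * ip mu (phi j) h.
Proof.
move=> h2; elim: n => [|n IH]; first by rewrite fourier_sum0 ip0 big_ord0.
rewrite fourier_sumS ip_lin ?big_ord_recr /= ?IH 1?addrC //.
  exact: L2_basis.
exact: L2_fourier_sum.
Qed.

Lemma coef_fourier_sum a n i :
  coef mu phi (fourier_sum a n) i = if (i < n)%N then a i else 0.
Proof.
have [_ onb _] := phiP.
rewrite /coef ip_fourier_sum; last exact: L2_basis.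
under eq_bigr do rewrite onb.
case: ifPn => [ilt|ige].
  rewrite (bigD1 (Ordinal ilt)) //= eqxx mulr1 big1 ?addr0 // => j.
  by rewrite -val_eqE /= => /negbTE ->; rewrite mulr0.
rewrite big1 // => j _; case: eqP => [e|_]; rewrite ?mulr0 //.
by rewrite -e ltn_ord in ige.
Qed.

Lemma L2norm_fourier_sum a n :
  L2norm mu (fourier_sum a n) = (Num.sqrt (\sum_(j < n) a j ^+ 2))%:E.
Proof.
have f2 := L2_fourier_sum a n.
rewrite L2normE // ip_fourier_sum //; congr (Num.sqrt _)%:E.
apply: eq_bigr => j _; rewrite ipC -/(coef mu phi _ _) coef_fourier_sum.
by rewrite ltn_ord expr2.
Qed.

(** The half of Parseval that rests on completeness: by Minkowski, the norm of [h] exceeds [B] by at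
    most the norm of [h] minus its n-th partial sum, and this tends to 0. *)
Lemma L2norm_le_coef h (B : R) : L2 mu h ->
  (forall n, \sum_(j < n) coef mu phi h j ^+ 2 <= B ^+ 2) -> 0 <= B ->
  (L2norm mu h <= B%:E)%E.
Proof.
move=> h2 hB B0; have [_ _ cvh] := phiP; have {}cvh := cvh _ h2.
have mf f : L2 mu f -> measurable_fun setT f.
  by move=> /sub_Lfun_mfun; rewrite inE.
suff H : forall n, (L2norm mu h - B%:E <=
    L2norm mu (fun x => (h x - \sum_(j < n) ip mu h (phi j) * phi j x)%R))%E.
  rewrite -sube_le0; apply: cvge_to_ge cvh _; exact: nearW.
move=> n; rewrite leeBlDr //.
have s2 := L2_fourier_sum (coef mu phi h) n.
have B' : (L2norm mu (fourier_sum (coef mu phi h) n) <= B%:E)%E.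
  rewrite L2norm_fourier_sum lee_fin -(ger0_norm B0) -sqrtr_sqr.
  by rewrite ler_sqrt ?hB // sqr_ge0.
apply: le_trans (leeD (lexx _) B').
apply: le_trans (eminkowski mu _ _ (lee1n 2)).
- rewrite /L2norm {1}(_ : h = (fun x =>
    h x - \sum_(j < n) ip mu h (phi j) * phi j x) \+
      fourier_sum (coef mu phi h) n); first exact: lexx.
  by apply/funext => x /=; rewrite subrK.
- apply: mf; exact: L2B.
- exact: mf.
Qed.

End L2.

(** * From packings to entropy *)

Section Entropy.
Context {R : realType} (mu : {measure set R -> \bar R}).
Implicit Types (F : set (R -> R)) (eps B : R).

Lemma M2_le eps F B : 1 <= B ->
  (forall n, is_packing mu eps F n -> n%:R <= B) -> (M2 mu eps F <= (ln B)%:E)%E.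
Proof.
move=> B1 H; rewrite /M2.
have : (packing_number mu eps F <= B%:E)%E.
  by apply: ge_ereal_sup => _ [n /H nB <-]; rewrite lee_fin.
case: packing_number => //= [r|_]; last exact: leNye.
rewrite !lee_fin => rB.
(* [ln] is 0 at nonpositive arguments, and [1 <= B] gives [0 <= ln B]. *)
have [r0|r0] := lerP r 0; first by rewrite ln0 // ln_ge0.
by rewrite ler_ln ?posrE // (lt_le_trans ltr01).
Qed.

Lemma M2_ge eps F n : (0 < n)%N -> is_packing mu eps F n ->
  ((ln n%:R)%:E <= M2 mu eps F)%E.
Proof.
move=> n0 Fn; rewrite /M2.
have : ((n%:R)%:E <= packing_number mu eps F)%E.
  by apply: ereal_sup_ubound; exists n.
case: packing_number => [r|//|//]; rewrite ?leey // !lee_fin => nr.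
by rewrite ler_ln ?posrE ?ltr0n // (lt_le_trans _ nr) // ltr0n.
Qed.

End Entropy.

(** * Coefficients in the class and the upper bound on packings *)

Section Theta.
Context {R : realType} (mu : {measure set R -> \bar R}).
Variables (phi : nat -> R -> R) (phiP : orthonormal_basis mu phi).
Variables (k A C : R) (A0 : 0 < A) (k12 : 1 / 2 < k) (C0 : 0 < C).

Lemma Theta_tail f (J n : nat) : Theta mu phi k A C f -> (0 < J)%N ->
  \sum_(J <= i < n) coef mu phi f i ^+ 2 <= C * J%:R `^ (1 - 2 * k).
Proof.
move=> [_ _ tail] J0; rewrite -lee_fin -sumEFin.
apply: le_trans (tail J J0); apply: nneseries_lim_ge => i _ _.
by rewrite lee_fin sqr_ge0.
Qed.

(** The tail condition at J = 1 bounds every coefficient except the one of index 0, which is added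
    separately. This provides the boundedness that [le_decr_rearr] asks for. *)
Lemma Theta_bounded f : Theta mu phi k A C f ->
  exists M, forall i, `|coef mu phi f i| <= M.
Proof.
move=> fT; exists (`|coef mu phi f 0| + Num.sqrt C) => -[|i].
  by rewrite lerDl sqrtr_ge0.
apply: (@le_trans _ _ (Num.sqrt C)); last by rewrite lerDr.
rewrite -sqrtr_sqr ler_sqrt ?(ltW C0) //.
have := Theta_tail _ 1 i.+2 fT isT; rewrite powR1 mulr1; apply: le_trans.
by rewrite big_nat_recr //= lerDr sumr_ge0 // => j _; rewrite sqr_ge0.
Qed.

(** The rearrangement condition in the form that [prod_le_of_rearrangement] consumes; the
    enumeration of [S] is the required injection. *)
Lemma Theta_level f (J : nat) (S : {set 'I_J}) t : Theta mu phi k A C f ->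
  (0 < #|S|)%N -> {in S, forall i : 'I_J, t <= `|coef mu phi f i|} ->
  t <= A * #|S|%:R `^ (- k).
Proof.
move=> fT S0 tS; have [M fM] := Theta_bounded _ fT; have [_ rearr _] := fT.
apply: le_trans (rearr _ S0).
apply: (le_decr_rearr _ _ M t #|S| (fun i => enum_val i : 'I_J)) => //.
  by move=> i j /val_inj /enum_val_inj.
by move=> i; apply: tS; exact: enum_valP.
Qed.

Lemma coefB f g j : L2 mu f -> L2 mu g ->
  coef mu phi (fun x => f x - g x) j = coef mu phi f j - coef mu phi g j.
Proof. by move=> f2 g2; rewrite /coef ipB //; exact: L2_basis. Qed.

(** The squared distance is split at [J]. The head gives [J * eta ^ 2]; in the tail, (x - y)^2 <= 2
    x^2 + 2 y^2 and one tail bound for each function give the constant 4. *)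
Lemma L2dist_le_quant f g (J : nat) (eta eps : R) :
  Theta mu phi k A C f -> Theta mu phi k A C g -> (0 < J)%N -> 0 <= eps ->
  (forall j : 'I_J, `|coef mu phi f j - coef mu phi g j| <= eta) ->
  J%:R * eta ^+ 2 + 4 * (C * J%:R `^ (1 - 2 * k)) <= eps ^+ 2 ->
  (L2dist mu f g <= eps%:E)%E.
Proof.
move=> fT gT J0 eps0 close le_eps; have [f2 _ _] := fT; have [g2 _ _] := gT.
apply: (L2norm_le_coef _ _ phiP) => //; first exact: L2B.
move=> n; apply: le_trans le_eps.
under eq_bigr do rewrite coefB //.
pose d j := (coef mu phi f j - coef mu phi g j) ^+ 2.
have d0 j : 0 <= d j by exact: sqr_ge0.
(* Extending the range to [J + n] allows the split at [J] whatever [n] is. *)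
apply: (@le_trans _ _ (\sum_(0 <= j < J + n) d j)).
  rewrite -(big_mkord xpredT d) [leRHS](@big_cat_nat _ _ _ n) //=.
    by rewrite lerDl sumr_ge0.
  exact: leq_addl.
rewrite (@big_cat_nat _ _ _ J) //= ?leq_addr //; apply: lerD.
  rewrite big_mkord -[X in X%:R * _]card_ord -sum1_card natr_sum mulr_suml.
  apply: ler_sum => j _; rewrite mul1r /d -real_normK ?num_real //.
  by rewrite lerXn2r ?nnegrE // (le_trans _ (close j)).
have tf := Theta_tail _ _ (J + n) fT J0; have tg := Theta_tail _ _ (J + n) gT J0.
apply: (@le_trans _ _ (2 * \sum_(J <= j < J + n) coef mu phi f j ^+ 2 +
                       2 * \sum_(J <= j < J + n) coef mu phi g j ^+ 2)).
  rewrite !mulr_sumr -big_split /=; apply: ler_sum => j _.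
  rewrite /d; set x := coef _ _ f j; set y := coef _ _ g j.
  rewrite -subr_ge0 (_ : _ - _ = (x + y) ^+ 2) ?sqr_ge0 //; ring.
lra.
Qed.

(** With equal signs the distance is that of the moduli, and these lie in a common interval of
    length [eta]. *)
Lemma dist_le_truncn (x y eta : R) : 0 < eta -> (0 <= x) = (0 <= y) ->
  Num.truncn (`|x| / eta) = Num.truncn (`|y| / eta) -> `|x - y| <= eta.
Proof.
move=> eta0 sgn tr.
have bd (z : R) : (Num.truncn (`|z| / eta))%:R * eta <= `|z| <
    (Num.truncn (`|z| / eta))%:R * eta + eta.
  rewrite -[X in _ + X]mul1r -mulrDl natr1 -ler_pdivlMr // -ltr_pdivrMr //.
  by apply: truncn_itv; rewrite divr_ge0 // ltW.
have := bd x; have := bd y; rewrite tr => /andP[y1 y2] /andP[x1 x2].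
have [x0|x0] := lerP 0 x.
  have y0 : 0 <= y by rewrite -sgn.
  rewrite !ger0_norm // in x1 x2 y1 y2; rewrite ler_norml; lra.
have y0 : y < 0 by rewrite ltNge -sgn -ltNge.
rewrite !ltr0_norm // in x1 x2 y1 y2; rewrite ler_norml; lra.
Qed.

(** Each packing point is encoded by the signs and rounded moduli of its first [J] coefficients.
    Separation makes the code injective, and the product bound on rounded moduli lets
    [card_prod_bound] count the codes. *)
Lemma packing_Theta_le (J n : nat) (c eta eps : R) : (0 < J)%N -> 0 < eta ->
  0 <= c -> A / eta = c * J%:R `^ k -> 0 <= eps ->
  J%:R * eta ^+ 2 + 4 * (C * J%:R `^ (1 - 2 * k)) <= eps ^+ 2 ->
  is_packing mu eps (Theta mu phi k A C) n ->
  n%:R <= ((((1 + c) * expR k) ^+ 2) * 4) ^+ J.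
Proof.
move=> J0 eta0 c0 cE eps0 le_eps [P [PT sep]].
have k0 : 0 <= k by have := k12; lra.
pose th i j := coef mu phi (P i) j.
pose m i j := Num.truncn (`|th i j| / eta).
pose N := Num.truncn (A / eta).
have mE i j : ((m i j)%:R <= `|th i j| / eta).
  by rewrite /m truncn_le divr_ge0 // ltW.
(* [Theta_level] on a singleton bounds each coefficient by [A], so the code alphabet is finite. *)
have mN i (j : 'I_J) : (m i j < N.+1)%N.
  rewrite ltnS; apply: le_truncn; rewrite ler_pM2r ?invr_gt0 //.
  have := Theta_level _ J [set j]%SET `|th i j| (PT i).
  rewrite cards1 powR1 mulr1; apply=> // l; by rewrite inE => /eqP ->.
pose code i : {ffun 'I_J -> bool * 'I_N.+1} :=
  [ffun j : 'I_J => (0 <= th i j, Ordinal (mN i j))].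
have code_inj : injective code.
  move=> i i' eqc; apply/eqP; apply: contraT => ne.
  have := sep _ _ ne; rewrite ltNge; apply: contraNT => _.
  apply: L2dist_le_quant le_eps => // j.
  have /ffunP/(_ j) := eqc; rewrite !ffunE => -[es em].
  exact: dist_le_truncn.
have K0 : 0 <= (1 + c) * expR k by rewrite mulr_ge0 ?expR_ge0 ?addr_ge0.
rewrite exprMn -exprM mulnC exprM.
apply: le_trans (card_prod_bound R J N.+1 _ (exprn_ge0 J K0)).
rewrite ler_nat -[leqLHS]card_ord -(card_imset _ code_inj).
apply/subset_leq_card/fintype.subsetP => _ /imsetP[i _ ->].
rewrite inE; under eq_bigr do rewrite ffunE /=.
have := prod_le_of_rearrangement R _ (fun j : 'I_J => (m i j)%:R)
  (fun j => c * (J%:R / j%:R) `^ k) _ _ [set: 'I_J]%SET.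
rewrite cardsT card_ord; under eq_bigl do rewrite inE.
move=> /(_ _ _)/le_trans; apply=> //; last exact: prod_rearrangement_bound.
(* Rounded moduli at least [t] on [S] mean coefficients of modulus at least [t * eta] there, so [t]
   is at most [A / eta] times the power -k of [#|S|]; [cE] turns this into the bound in
   [J / #|S|]. *)
move=> S t S0 tS.
have : t * eta <= A * #|S|%:R `^ (- k).
  apply: (Theta_level _ _ _ _ (PT i)) => // j jS.
  by rewrite -ler_pdivlMr // (le_trans _ (mE i j)) // tS.
rewrite -ler_pdivlMr // mulrAC cE powRM ?invr_ge0 // -powR_inv1 // -powRrM mulN1r.
by rewrite mulrA.
Qed.

(** * Cubes inside the class and the lower bound on packings *)

Definition cube_coef (a : R) (J : nat) (g : {ffun 'I_J -> bool}) (j : nat) : R :=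
  if insub j is Some i then a * (g i)%:R else 0.

Lemma cube_coef_ord a J (g : {ffun 'I_J -> bool}) (j : 'I_J) :
  cube_coef a J g j = a * (g j)%:R.
Proof. by rewrite /cube_coef valK. Qed.

Lemma cube_coef_ge a J (g : {ffun 'I_J -> bool}) j :
  (J <= j)%N -> cube_coef a J g j = 0.
Proof. by move=> Jj; rewrite /cube_coef insubF // ltnNge Jj. Qed.

Lemma cube_coef_le a J (g : {ffun 'I_J -> bool}) j : 0 <= a ->
  `|cube_coef a J g j| <= a.
Proof.
move=> a0; rewrite /cube_coef; case: insub => [i|]; last by rewrite normr0.
by case: (g i); rewrite ?mulr1 ?mulr0 ?normr0 // ger0_norm.
Qed.

Lemma coef_cube a J (g : {ffun 'I_J -> bool}) :
  coef mu phi (fourier_sum phi (cube_coef a J g) J) = cube_coef a J g.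
Proof.
apply/funext => j; rewrite (coef_fourier_sum _ _ phiP).
by case: ltnP => // Jj; rewrite cube_coef_ge.
Qed.

Lemma L2dist_cube a J (g g' : {ffun 'I_J -> bool}) :
  L2dist mu (fourier_sum phi (cube_coef a J g) J)
            (fourier_sum phi (cube_coef a J g') J)
  = (Num.sqrt (a ^+ 2 * (hamming g g')%:R))%:E.
Proof.
rewrite /L2dist (_ : (fun=> _) =
    fourier_sum phi (fun j => cube_coef a J g j - cube_coef a J g' j) J).
  rewrite (L2norm_fourier_sum _ _ phiP) /hamming -sum1_card natr_sum mulr_sumr.
  congr (Num.sqrt _)%:E; rewrite [RHS]big_mkcond; apply: eq_bigr => i _ /=.
  rewrite !cube_coef_ord inE.
  by case: (g i); case: (g' i) => /=; ring.
apply/funext => x; rewrite /fourier_sum -sumrB; apply: eq_bigr => j _.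
by rewrite mulrBl.
Qed.

(** Both conditions are tightest at J: ranks and tails beyond [J] vanish, and the bounds assumed at
    [J] pass to smaller indices because the powers decrease. *)
Lemma Theta_cube a J (g : {ffun 'I_J -> bool}) : 0 <= a ->
  a <= A * J%:R `^ (- k) -> a ^+ 2 * J%:R <= C * J%:R `^ (1 - 2 * k) ->
  Theta mu phi k A C (fourier_sum phi (cube_coef a J g) J).
Proof.
have := k12; have := A0; have := C0 => Cpos Apos kgt a0 aA aC.
split; first exact: (L2_fourier_sum _ _ phiP).
- move=> j j0; rewrite coef_cube; apply: decr_rearr_le; last first.
    by rewrite mulr_ge0 ?powR_ge0 // ltW.
  move=> s sinj; have [jJ|Jj] := leqP j J.
    exists (Ordinal j0); apply: le_trans (cube_coef_le _ _ _ _ a0) _.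
    apply: le_trans aA _; rewrite ler_wpM2l ?(ltW Apos) //.
    by apply: powRN_le; rewrite ?ltr0n ?ler_nat //; lra.
  (* Pigeonhole: more than [J] distinct indices cannot all lie below [J]. *)
  have [i si] : exists i, (J <= s i)%N.
    apply/not_existsP => sJ; have {}sJ i : (s i < J)%N by rewrite ltnNge; apply/negP.
    have /leq_card : injective (fun i => Ordinal (sJ i)).
      by move=> i i' [] /sinj.
    by rewrite !card_ord leqNgt Jj.
  by exists i; rewrite cube_coef_ge // normr0 mulr_ge0 ?powR_ge0 ?(ltW Apos).
move=> m m0; rewrite coef_cube.
apply: lime_le; first by apply: is_cvg_nneseries => i _ _; rewrite lee_fin sqr_ge0.
apply: nearW => n; rewrite sumEFin lee_fin.
have [mJ|Jm] := ltnP m J; last first.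
  rewrite big_nat big1 ?mulr_ge0 ?powR_ge0 ?(ltW Cpos) // => i /andP[mi _].
  by rewrite cube_coef_ge ?expr0n // (leq_trans Jm).
apply: (@le_trans _ _ (C * J%:R `^ (1 - 2 * k))); last first.
  have -> : 1 - 2 * k = - (2 * k - 1) by ring.
  rewrite ler_wpM2l ?(ltW Cpos) //.
  by apply: powRN_le; rewrite ?ltr0n ?ler_nat ?(ltnW mJ) //; lra.
apply: le_trans aC.
have sq0 i : 0 <= cube_coef a J g i ^+ 2 by exact: sqr_ge0.
(* This range contains both [[m, n)] and [[0, J)], in whatever order their endpoints come. *)
apply: (@le_trans _ _ (\sum_(0 <= i < m + J + n) cube_coef a J g i ^+ 2)).
  rewrite [leRHS](@big_cat_nat _ _ _ m) //= -?addnA ?leq_addr //.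
  rewrite -[leLHS]add0r lerD ?sumr_ge0 //.
  have [mn|nm] := leqP m n; last by rewrite big_geq ?sumr_ge0 // ltnW.
  rewrite [leRHS](@big_cat_nat _ _ _ n) //= ?lerDl ?sumr_ge0 //.
  by rewrite addnA leq_addl.
rewrite (@big_cat_nat _ _ _ J) //=; last by rewrite addnAC leq_addl.
rewrite [X in _ + X]big_nat [X in _ + X]big1 ?addr0; last first.
  by move=> i /andP[Ji _]; rewrite cube_coef_ge // expr0n.
rewrite big_mkord -[X in X%:R]card_ord -sum1_card natr_sum mulr_sumr.
apply: ler_sum => i _; rewrite mulr1 -real_normK ?num_real //.
by rewrite lerXn2r ?nnegrE // cube_coef_le.
Qed.

(** Distinct code words differ in more than J/4 places, so the squared distances exceed
    [a ^ 2 * J / 4], whence the factor 4 before [eps ^ 2]. *)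
Lemma packing_Theta_ge (J : nat) (a eps : R) : 0 <= eps ->
  0 < a -> a <= A * J%:R `^ (- k) -> a ^+ 2 * J%:R <= C * J%:R `^ (1 - 2 * k) ->
  4 * eps ^+ 2 <= a ^+ 2 * J%:R ->
  exists n, (108 / 97) ^+ J <= n%:R :> R /\
    is_packing mu eps (Theta mu phi k A C) n.
Proof.
move=> eps0 a0 aA aC le_a.
have [S [sep cardS]] := gilbert_varshamov R J.
exists #|S|; split=> //.
exists (fun i => fourier_sum phi (cube_coef a J (enum_val i)) J); split.
  by move=> i; apply: Theta_cube => //; exact: ltW.
move=> i j ij; rewrite L2dist_cube lte_fin -(ger0_norm eps0) -sqrtr_sqr.
have sij : (J < 4 * hamming (enum_val i) (enum_val j))%N.
  by apply: sep; rewrite ?enum_valP // (inj_eq enum_val_inj).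
have a2 : 0 < a ^+ 2 by rewrite exprn_gt0.
rewrite ltr_sqrt; last first.
  by rewrite mulr_gt0 // ltr0n; case: hamming sij.
rewrite -(ltr_pM2l (x := 4)) //; apply: le_lt_trans le_a _.
by rewrite mulrCA ltr_pM2l // -natrM ltr_nat.
Qed.
End Theta.

(** * Choice of the dimension and the final bounds *)

(** Balances the errors: with a step of order J^-k, rounding J coefficients costs as much as the
    tail. *)
Lemma mulr_powRN_sqr (R : realType) (x k : R) : 0 < x ->
  x * (x `^ (- k)) ^+ 2 = x `^ (1 - 2 * k).
Proof.
move=> x0; have xN0 : x != 0 by rewrite gt_eqF.
rewrite powRD ?xN0 ?implybT // powRr1 ?ltW //; congr (_ * _).
by rewrite -powR_mulrn ?powR_ge0 // -powRrM mulNr mulrC.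
Qed.

(** The solution x of B x^(1-2k) = eps^2, written so that the power of [eps] stands out; the integer
    [J] is x rounded up or down. *)
Definition rate {R : realType} (k B eps : R) : R :=
  B `^ (2 * k - 1)^-1 * eps `^ (- (2 / (2 * k - 1))).

Lemma rateP (R : realType) (k B eps : R) : 1 / 2 < k -> 0 < B -> 0 < eps ->
  eps ^+ 2 <= B ->
  1 <= rate k B eps /\ rate k B eps `^ (1 - 2 * k) = eps ^+ 2 / B.
Proof.
move=> k12 B0 eps0 epsB; have p0 : 0 < 2 * k - 1 by lra.
have pN0 : 2 * k - 1 != 0 by rewrite gt_eqF.
have eps2 : 0 < eps ^+ 2 by rewrite exprn_gt0.
have -> : rate k B eps = (B / eps ^+ 2) `^ (2 * k - 1)^-1.
  rewrite /rate powRM ?invr_ge0 ?ltW //; congr (_ * _).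
  by rewrite -(powR_inv1 (ltW eps2)) -(powR_mulrn 2 (ltW eps0)) -!powRrM
    mulN1r mulrN.
split.
  have e1 : 1 `^ (2 * k - 1)^-1 = 1 :> R by rewrite powR1.
  rewrite -[leLHS]e1; apply: ge0_ler_powR.
  - by rewrite invr_ge0 ltW.
  - by rewrite nnegrE.
  - by rewrite nnegrE divr_ge0 // ltW.
  - by rewrite ler_pdivlMr // mul1r.
rewrite -powRrM (_ : (2 * k - 1)^-1 * _ = -1) ?powR_inv1 ?invf_div //; last by field.
by rewrite divr_ge0 // ltW.
Qed.

Section Bounds.
Context {R : realType} (mu : {measure set R -> \bar R}).
Variables (phi : nat -> R -> R) (phiP : orthonormal_basis mu phi).
Variables (k A C : R).
Hypotheses (A0 : 0 < A) (k12 : 1 / 2 < k) (C0 : 0 < C).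

Lemma M2_Theta_le (eps : R) : 0 < eps -> eps ^+ 2 <= 8 * C ->
  (M2 mu eps (Theta mu phi k A C) <=
   (2 * ln (((1 + A / (2 * Num.sqrt C)) * expR k) ^+ 2 * 4) *
      rate k (8 * C) eps)%:E)%E.
Proof.
move=> eps0 epsC; have B0 : 0 < 8 * C by rewrite mulr_gt0.
have [x1 xp] := rateP _ _ _ _ k12 B0 eps0 epsC.
set x := rate _ _ _ in x1 xp *; set c := A / _; set K := _ * 4.
have sC : 0 < Num.sqrt C by rewrite sqrtr_gt0.
have c0 : 0 <= c by rewrite divr_ge0 ?mulr_ge0 ?ltW.
have x0 : 0 < x by rewrite (lt_le_trans ltr01).
(* Going above x makes the error small enough, and [1 <= x] keeps [J] below 2x. The step 2 sqrt(C)
   J^-k yields a rounding error 4 C J^(1-2k), which with the equal tail term gives the 8 C in the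
   rate. *)
pose J := (Num.truncn x).+1.
have xJ : x <= J%:R by apply/ltW/truncnS_gt.
have J2x : J%:R <= 2 * x.
  by rewrite /J -natr1; have := truncn_le x; rewrite (ltW x0); lra.
have J0 : 0 < J%:R :> R by rewrite ltr0n.
have K1 : 1 <= K.
  have e1 : 1 <= (1 + c) * expR k.
    by rewrite mulr_ege1 ?lerDl // -expR0 ler_expR; have := k12; lra.
  by rewrite /K; have : 1 <= ((1 + c) * expR k) ^+ 2; [exact: exprn_ege1|lra].
apply: (@le_trans _ _ (ln (K ^+ J))%:E).
  apply: M2_le; first exact: exprn_ege1.
  move=> n; apply: (packing_Theta_le _ _ phiP _ _ _ k12 C0 _ _ c
    (2 * Num.sqrt C * J%:R `^ (- k))) => //.
  - by rewrite !mulr_gt0 ?powR_gt0.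
  - by rewrite powRN invfM invrK mulrA.
  - exact: ltW.
  - rewrite exprMn mulrCA mulr_powRN_sqr // exprMn sqr_sqrtr ?(ltW C0) //.
    have : J%:R `^ (1 - 2 * k) <= eps ^+ 2 / (8 * C).
      rewrite -xp (_ : 1 - 2 * k = - (2 * k - 1)); last by ring.
      by apply: powRN_le => //; have := k12; lra.
    rewrite ler_pdivlMr //; lra.
rewrite lee_fin lnXn ?(lt_le_trans ltr01) // -[leLHS]mulr_natl [leRHS]mulrAC.
by rewrite ler_wpM2r // ln_ge0.
Qed.

Lemma M2_Theta_ge (eps : R) : 0 < eps ->
  let a := Num.min A (Num.sqrt C) in eps ^+ 2 <= a ^+ 2 / 4 ->
  ((ln (108 / 97) / 2 * rate k (a ^+ 2 / 4) eps)%:E <=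
   M2 mu eps (Theta mu phi k A C))%E.
Proof.
move=> eps0 a epsB.
have a0 : 0 < a by rewrite lt_min A0 sqrtr_gt0.
have B0 : 0 < a ^+ 2 / 4 by rewrite divr_gt0 // exprn_gt0.
have [x1 xp] := rateP _ _ _ _ k12 B0 eps0 epsB.
set x := rate _ _ _ in x1 xp *.
have x0 : 0 < x by rewrite (lt_le_trans ltr01).
(* Here [J] stays below x, so that the cube of side [a * J ^ (-k)] is wide enough; [1 <= x] gives
   [0 < J] and x <= 2J. The minimum [a] meets the rearrangement condition through [A] and the tail
   condition through [sqrt C]. *)
pose J := Num.truncn x.
have J1 : (0 < J)%N by rewrite truncn_gt0.
have J0 : 0 < J%:R :> R by rewrite ltr0n.
have Jx : J%:R <= x by rewrite truncn_le ltW.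
have xJ : x <= 2 * J%:R.
  have := truncnS_gt x; rewrite -/J -natr1 => /ltW.
  have : 1 <= J%:R :> R by rewrite ler1n.
  lra.
have x2J : 2^-1 * x <= J%:R by rewrite mulrC ler_pdivrMr // mulrC.
have L0 : 0 <= ln (108 / 97) :> R.
  by rewrite ln_ge0 // ler_pdivlMr // mul1r ler_nat.
have Jk : 0 < J%:R `^ (- k) by rewrite powR_gt0.
have a2J : (a * J%:R `^ (- k)) ^+ 2 * J%:R = a ^+ 2 * J%:R `^ (1 - 2 * k).
  by rewrite exprMn -mulrA [_ * J%:R]mulrC mulr_powRN_sqr.
have [|||||n [nJ packn]] := packing_Theta_ge _ _ phiP _ _ _ A0 k12 C0 J
    (a * J%:R `^ (- k)) eps.
- exact: ltW.
- by rewrite mulr_gt0.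
- by rewrite ler_pM2r // ge_min lexx.
- rewrite a2J ler_wpM2r ?powR_ge0 // -[leRHS]sqr_sqrtr ?(ltW C0) //.
  by rewrite lerXn2r ?nnegrE ?sqrtr_ge0 ?(ltW a0) // ge_min lexx orbT.
- rewrite a2J; have : eps ^+ 2 / (a ^+ 2 / 4) <= J%:R `^ (1 - 2 * k).
    rewrite -xp (_ : 1 - 2 * k = - (2 * k - 1)); last by ring.
    by apply: powRN_le => //; have := k12; lra.
  by rewrite ler_pdivrMr //; lra.
have b0 : 0 < (108 / 97) ^+ J :> R by rewrite exprn_gt0 // divr_gt0.
have n0 : 0 < n%:R :> R by exact: lt_le_trans nJ.
apply: le_trans (M2_ge _ _ _ _ _ packn); last by rewrite -(ltr0n R).
rewrite lee_fin; apply: (@le_trans _ _ (ln ((108 / 97) ^+ J))); last first.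
  by rewrite ler_ln ?posrE.
rewrite lnXn ?divr_gt0 //; move: (ln _) L0 => L L0.
by rewrite -[leRHS]mulr_natr -mulrA ler_wpM2l.
Qed.

End Bounds.

Theorem theorem1 (R : realType) (mu : {measure set R -> \bar R})
    (phi : nat -> R -> R) (A k C : R) :
  mu (~` `[0, 1]%classic) = 0%E ->
  orthonormal_basis mu phi ->
  0 < A -> 1 / 2 < k -> 0 < C ->
  exists c1 c2 : R, [/\ 0 < c1, c1 <= c2 &
    exists e0 : R, 0 < e0 /\
      forall eps : R, 0 < eps -> eps < e0 ->
        ((c1 * eps `^ (- (2 / (2 * k - 1))))%:E <= M2 mu eps (Theta mu phi k A C))%E /\
        (M2 mu eps (Theta mu phi k A C) <= (c2 * eps `^ (- (2 / (2 * k - 1))))%:E)%E].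
Proof.
move=> _ phiP A0 k12 C0.
pose a := Num.min A (Num.sqrt C).
have a0 : 0 < a by rewrite lt_min A0 sqrtr_gt0.
pose c1 := ln (108 / 97) / 2 * (a ^+ 2 / 4) `^ (2 * k - 1)^-1.
pose c2 := 2 * ln (((1 + A / (2 * Num.sqrt C)) * expR k) ^+ 2 * 4) *
  (8 * C) `^ (2 * k - 1)^-1.
exists c1, (Num.max c1 c2); split.
- rewrite mulr_gt0 ?powR_gt0 ?divr_gt0 ?exprn_gt0 // ln_gt0 //; lra.
- by rewrite le_max lexx.
(* The threshold encodes eps^2 <= a^2/4 and eps^2 <= 8C, the ranges in which the two rates are at
   least 1. *)
exists (Num.min (a / 2) (Num.sqrt (8 * C))); split.
  by rewrite lt_min divr_gt0 // sqrtr_gt0 mulr_gt0.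
move=> eps eps0; rewrite lt_min => /andP[/ltW epsa /ltW epsC]; split.
  rewrite -mulrA; apply: (M2_Theta_ge _ _ phiP _ _ _ A0 k12 C0) => //.
  rewrite -/a (_ : _ / 4 = (a / 2) ^+ 2); last by field.
  by rewrite lerXn2r ?nnegrE ?divr_ge0 ?(ltW eps0) ?(ltW a0).
apply: le_trans (M2_Theta_le _ _ phiP _ _ _ A0 k12 C0 _ eps0 _) _.
  by rewrite -(@sqr_sqrtr _ (8 * C)) ?mulr_ge0 ?(ltW C0) // lerXn2r
    ?nnegrE ?sqrtr_ge0 ?(ltW eps0).
by rewrite lee_fin mulrA ler_wpM2r ?powR_ge0 // le_max lexx orbT.
Qed.
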